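(* Let $n,k$ be integers. If $k\ge n\ge 2$, then each subgroup $G\le S_n$ is Galois closed over $\mathbf{k}$. If $2\le k<n$, then $A_n$ is not Galois closed over $\mathbf{k}$.
   Context: For a positive integer $m$ put $\mathbf{m}=\{1,\dots,m\}$. $S_n$ and $A_n$ are the symmetric and alternating groups on $\mathbf{n}$. A permutation $\sigma\in S_n$ (written $i\mapsto i\sigma$) leaves an operation $f\colon\mathbf{k}^n\to\mathbf{k}$ invariant if $f(x_1,\dots,x_n)=f(x_{1\sigma},\dots,x_{n\sigma})$ for all $(x_1,\dots,x_n)\in\mathbf{k}^n$. For $G\le S_n$, the Galois closure $\overline{G}^{(k)}$ of $G$ over $\mathbf{k}$ is the subgroup of $S_n$ consisting of all $\sigma\in S_n$ such that every $f\colon\mathbf{k}^n\to\mathbf{k}$ that is invariant under all elements of $G$ is also invariant under $\sigma$. $G$ is Galois closed over $\mathbf{k}$ if $\overline{G}^{(k)}=G$. *)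

(* Defs.v *)
From HB Require Import structures.
From mathcomp Require Import all_boot all_fingroup all_solvable.

Set Implicit Arguments.
Unset Strict Implicit.
Unset Printing Implicit Defensive.

Import GroupScope.

(* The set {1, ..., m} is modelled by 'I_m = {0, ..., m-1}. *)
Definition operation (n k : nat) := {ffun {ffun 'I_n -> 'I_k} -> 'I_k}.

Definition leaves_invariant (n k : nat) (s : 'S_n) (f : operation n k) : bool :=
  [forall x : {ffun 'I_n -> 'I_k}, f x == f [ffun i => x (s i)]].

Definition galois_closure (n k : nat) (G : {set 'S_n}) : {set 'S_n} :=
  [set s : 'S_n | [forall f : operation n k,
     [forall t in G, leaves_invariant t f] ==> leaves_invariant s f]].

Lemma galois_closure_group_set (n k : nat) (G : {set 'S_n}) :
  group_set (galois_closure k G).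
Proof.
apply/group_setP; split=> [|s t].
  rewrite inE; apply/forallP=> f; apply/implyP=> _; apply/forallP=> x.
  by apply/eqP; congr (f _); apply/ffunP=> i; rewrite ffunE perm1.
rewrite !inE => /forallP sG /forallP tG; apply/forallP=> f; apply/implyP=> fG.
have /forallP sf := implyP (sG f) fG; have /forallP tf := implyP (tG f) fG.
apply/forallP=> x; rewrite (eqP (tf x)) (eqP (sf _)); apply/eqP; congr (f _).
by apply/ffunP=> i; rewrite !ffunE permM.
Qed.

Canonical galois_closure_group (n k : nat) (G : {set 'S_n}) : {group 'S_n} :=
  Group (galois_closure_group_set k G).

Definition galois_closed (n k : nat) (G : {group 'S_n}) : Prop :=
  galois_closure k G = G.

(* Main.v *)
Require Import Defs.
From mathcomp Require Import all_boot all_fingroup all_solvable.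

(** The group G acts on the tuples x by x |-> (i |-> x (s i)), and its
    closure consists of the permutations preserving every orbit of G.
    If n <= k, a tuple with distinct entries has trivial stabiliser, so
    the indicator function of its orbit separates G from any s outside G.
    If k < n, every tuple has two equal entries, hence is fixed by a
    transposition, and so A_n and S_n have the same orbits. *)

Lemma galois_closure_sub (n k : nat) (G : {group 'S_n}) :
  1 < k -> n <= k -> galois_closure k G \subset G.
Proof.
move=> k_gt1 le_nk; apply/subsetP=> s; rewrite inE => /forallP clG.
pose x0 : {ffun 'I_n -> 'I_k} := [ffun i => widen_ord le_nk i].
pose orb (x : {ffun 'I_n -> 'I_k}) :=
  [exists t in G, x == [ffun i => x0 (t i)]].
pose f : operation n k :=
  [ffun x => if orb x then Ordinal k_gt1 else Ordinal (ltnW k_gt1)].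
have orbG t x : t \in G -> orb x -> orb [ffun i => x (t i)].
  move=> Gt /exists_inP[u Gu /eqP->]; apply/exists_inP.
  exists (t * u)%g; first by rewrite groupM.
  by apply/eqP/ffunP=> i; rewrite !ffunE permM.
have fG : [forall t in G, leaves_invariant t f].
  apply/forall_inP=> t Gt; apply/forallP=> x; rewrite !ffunE.
  suff -> : orb [ffun i => x (t i)] = orb x by [].
  apply/idP/idP; last exact: orbG.
  move=> /(orbG t^-1%g); rewrite groupV => /(_ Gt).
  congr (is_true (orb _)); apply/ffunP=> i; by rewrite !ffunE permKV.
have /forallP/(_ x0) := implyP (clG f) fG; rewrite !ffunE.
have -> : orb x0.
  by apply/exists_inP; exists 1%g => //; apply/eqP/ffunP=> i; rewrite !ffunE perm1.
(* Since [f x0] is 1, the value at [x0] composed with [s] cannot be 0, so this tuple is also [x0]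
   composed with some [t] in [G]. *)
case: ifP => // /exists_inP[t Gt /eqP/ffunP eq_st] _.
suff -> : s = t by [].
by apply/permP=> i; move/(_ i): eq_st; rewrite !ffunE => -[/val_inj].
Qed.

Lemma galois_closure_Alt (n k : nat) :
  k < n -> galois_closure k ('Alt_('I_n))%g = [set: 'S_n].
Proof.
move=> lt_kn; apply/setP=> s; rewrite !inE.
apply/forallP=> f; apply/implyP=> /forall_inP fA; apply/forallP=> x.
have [s_odd | s_even] := boolP (odd_perm s); last first.
  by have /forallP := fA s (etrans (Alt_even _) s_even); apply.
have /injectivePn[i [j ne_ij eq_x]] : ~~ injectiveb x.
  apply/injectiveP=> /leq_card; by rewrite !card_ord leqNgt lt_kn.
(* The product applies [s] first, so the swap acts on the indices read by [x], where [x i = x j]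
   makes it invisible. *)
have Ast : (s * tperm i j)%g \in ('Alt_('I_n))%g.
  by rewrite Alt_even odd_permM s_odd odd_tperm ne_ij.
have /forallP/(_ x)/eqP-> := fA _ Ast.
apply/eqP; congr (f _); apply/ffunP=> m; rewrite !ffunE permM.
by case: tpermP => // ->.
Qed.

Theorem proposition3p3 (n k : nat) :
  (2 <= n -> n <= k -> forall G : {group 'S_n}, galois_closed k G) /\
  (2 <= k -> k < n -> ~ galois_closed k 'Alt_('I_n)%G).
Proof.
split=> [n_gt1 le_nk G | k_gt1 lt_kn].
  apply/eqP; rewrite eqEsubset galois_closure_sub ?(leq_trans n_gt1) //=.
  apply/subsetP=> s Gs; rewrite inE; apply/forallP=> f.
  by apply/implyP=> /forall_inP; apply.
rewrite /galois_closed galois_closure_Alt //.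
have n_gt1 : 1 < n by apply: leq_trans (ltnW lt_kn).
(* The transposition of 0 and 1 is odd, so the closure, all of ['S_n], exceeds ['Alt_('I_n)]. *)
pose i : 'I_n := Ordinal (ltnW n_gt1); pose j : 'I_n := Ordinal n_gt1.
by move/setP/(_ (tperm i j)); rewrite inE Alt_even odd_tperm.
Qed.
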